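(* Let $H\in(0,1)$, let $\nu=\nu_\varepsilon\ge0$ and $\sigma=\sigma_\varepsilon>0$ satisfy $\nu=\mathcal{O}(\varepsilon^2)$, $\sigma=\mathcal{O}(\varepsilon^{2H+1})$ and $\nu^{H+1/2}\ll\sigma$, and fix $T_0>0$. Let $b$ be a solution, with deterministic initial condition $b_0$, of the scalar stochastic differential equation $$\mathrm{d}b=\mathcal{F}_c(b)\,\mathrm{d}T+\mathrm{d}\beta^H_{\sigma^H}(T),\qquad b(0)=b_0,$$ and let $\lambda_T(b_0)=\frac1T\ln\exp\Big(\int_0^TD\mathcal{F}_c(b(s))\,\mathrm{d}s\Big)$ be its finite-time Lyapunov exponent. Then there are a constant $c>0$ and, for each $\theta>0$, a time $T_\theta>0$ with $T_\theta\to0$ as $\theta\to0$, such that, uniformly for all $T\in[T_\theta,T_0]$, $$\mathbb{P}\big(\lambda_T(b_0)<-c\,\theta^2\big)\to1\qquad\text{as }\theta\to0.$$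
   Context: $\mathcal{H}$ is a separable Hilbert space and $A$ a symmetric non-positive linear operator generating a compact analytic semigroup on $\mathcal{H}$, with one-dimensional kernel $\mathcal{N}$, identified with $\mathbb{R}$ through a unit vector. $P_c$ is the orthogonal projection onto $\mathcal{N}$. For $\alpha\ge 0$, $\mathcal{H}^\alpha=D((1-A)^\alpha)$, and $\mathcal{H}^{-\alpha}$ is the dual of $\mathcal{H}^\alpha$. $X$ is a Banach space with $\mathcal{H}^\alpha\subset X\subset\mathcal{H}$ continuously and densely for some $\alpha\in(0,1/2)$. $\mathcal{F}:X\to X^*\subset\mathcal{H}^{-\alpha}$ is a cubic nonlinearity, $\mathcal{F}(u)=\mathcal{F}(u,u,u)$ with $\mathcal{F}(\cdot,\cdot,\cdot)$ trilinear, satisfying $\langle\mathcal{F}(u)-\mathcal{F}(v),u-v\rangle\le -c\|u-v\|_X^4$ for all $u,v\in X$ and some $c>0$. $\mathcal{F}_c:=P_c\mathcal{F}$ restricted to $\mathcal{N}\cong\mathbb{R}$; it has the form $\mathcal{F}_c(b)=-c_0b^3$ with $c_0>0$, so that $D\mathcal{F}_c(b)=-3c_0b^2$. $\beta^H$ is an $\mathcal{N}$-valued (i.e. scalar, non-degenerate) fractional Brownian motion with Hurst index $H$, and for $\gamma>0$, $\beta^H_\gamma(T)=\gamma^{2H}\beta^H(T\gamma^{-2})$, which is again a fractional Brownian motion with the same law. $F_\varepsilon=\mathcal{O}(f_\varepsilon)$ means there are $\varepsilon$-independent $C,\varepsilon_0>0$ with $|F_\varepsilon|\le Cf_\varepsilon$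 for all $\varepsilon\in(0,\varepsilon_0]$; $f_\varepsilon\ll g_\varepsilon$ means $f_\varepsilon/g_\varepsilon\to0$ as $\varepsilon\to0$. *)

(* Defs.v *)
From HB Require Import structures.
From mathcomp Require Import all_boot all_order all_algebra.
From mathcomp Require Import all_classical all_reals all_analysis.

Set Implicit Arguments.
Unset Strict Implicit.
Unset Printing Implicit Defensive.

Import Order.TTheory GRing.Theory Num.Theory.
Import numFieldNormedType.Exports.

Local Open Scope classical_set_scope.
Local Open Scope ring_scope.

Section asymptotics.
Context {R : realType}.
Implicit Types F f g : R -> R.

Definition bigO_eps F f : Prop :=
  exists C e0 : R, [/\ 0 < C, 0 < e0 &
    forall e, 0 < e <= e0 -> `|F e| <= C * f e].

Definition much_smaller f g : Prop := f e / g e @[e --> 0^'+] --> (0 : R).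

End asymptotics.

Section fractional_brownian_motion.
Context {d : measure_display} {Om : measurableType d} {R : realType}.
Variable P : probability Om R.

(* Point masses count as Gaussian; they have to be singled out because the
   library's [normal_prob m 0] is not the Dirac mass at [m]. *)
Definition gaussian_rv (X : Om -> R) : Prop :=
  (exists m : R, {ae P, forall w, X w = m}) \/
  (exists m s : R, 0 < s /\
     forall A : set R, measurable A -> P (X @^-1` A) = normal_prob m s A).

Definition gaussian_process (X : R -> {RV P >-> R}) : Prop :=
  forall (n : nat) (t a : 'I_n -> R), (forall i, 0 <= t i) ->
    gaussian_rv (fun w => \sum_(i < n) a i * X (t i) w).

(* The real number [q] is the variance at time 1: the motion need not be
   standard, only non-degenerate. *)
Definition fractional_brownian_motion (H q : R) (X : R -> {RV P >-> R}) : Prop :=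
  [/\ gaussian_process X,
      forall t, 0 <= t -> ('E_P[X t] = 0)%E,
      forall s t, 0 <= s -> 0 <= t ->
        covariance P (X s) (X t) =
        (q / 2 * (s `^ (2 * H) + t `^ (2 * H) - `|t - s| `^ (2 * H)))%:E &
      {ae P, forall w, X 0 w = 0 /\
         {within `[0, +oo[, continuous (fun t => X t w)}}].

Definition rescaled (H g : R) (X : R -> {RV P >-> R}) (t : R) (w : Om) : R :=
  g `^ (2 * H) * X (t * g ^- 2) w.

End fractional_brownian_motion.

Section scalar_sde.
Context {R : realType}.

Definition Fc (c0 b : R) : R := - c0 * b ^+ 3.

(* [b] solves db = F(b) dt + dN on [0, T0] with b(0) = b0: the noise is
   additive, so the equation is understood pathwise in integrated form.
   The equation holds almost surely, but all
   paths are continuous, so that path integrals are measurable in [w]. *)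
Definition sde_solution {d} {Om : measurableType d} (P : probability Om R)
    (F : R -> R) (N : R -> Om -> R) (b0 T0 : R) (b : R -> {RV P >-> R}) : Prop :=
  (forall w, {within `[0, T0], continuous (fun t => b t w)}) /\
  {ae P, forall w, b 0 w = b0 /\
     forall t, 0 <= t <= T0 ->
       b t w = b0 + Rintegral lebesgue_measure `[0, t] (fun s => F (b s w))
               + (N t w - N 0 w)}.

Definition lyapunov_exponent (F : R -> R) (T : R) (path : R -> R) : R :=
  T^-1 * ln (expR (Rintegral lebesgue_measure `[0, T]
                     (fun s => (F^`())%classic (path s)))).

End scalar_sde.

(* Main.v *)
(** Only the one-dimensional Gaussian marginals of the noise are needed.
    Writing [N] for the noise, [lambda_T >= - 3 c0 theta^2] means
    [\int_0^T b^2 <= theta^2 T].  Since [Y = b - N] is C^1 with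
    [Y' = - c0 b^3], testing with [Y] gives
    [\int_0^T b^4 <= 2 b0^2 / c0 + \int_0^T N^4], which is bounded with high
    probability because [E N_t^4] is.  Interpolating [|b|^3] between [b^2] and
    [b^4] then makes [c0 \int_0^t b^3 = b0 + N_t - b_t] of order [theta]
    uniformly in [t <= T], so [b0 + N] is of order [theta] in mean square on
    [[0, T]] and spends at least a quarter of the time [T] in a ball of radius
    of order [theta] during [[T / 2, T]].  The expected time spent there is at
    most of order [T theta / T^H], which is negligible against [T] as soon as
    [T >= theta^(1 / (2 H))].  All bounds are uniform in epsilon because the
    rescaled noise has the same marginals for all epsilon. *)

Require Import Defs.
From HB Require Import structures.
From mathcomp Require Import all_boot all_order all_algebra.
From mathcomp Require Import all_classical all_reals all_analysis.
From mathcomp Require Import measurable_realfun ring lra.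

Set Implicit Arguments.
Unset Strict Implicit.
Unset Printing Implicit Defensive.

Import Order.TTheory GRing.Theory Num.Theory.
Import numFieldNormedType.Exports.

Local Open Scope classical_set_scope.
Local Open Scope ring_scope.

(** * Deterministic estimates along a single path *)

Section pathwise.
Context {R : realType}.
Local Notation mu := (@lebesgue_measure R).
Implicit Types b N f g : R -> R.

Lemma continuous_itv_integrable f (x y : R) : continuous f ->
  mu.-integrable `[x, y] (EFin \o f).
Proof.
move=> cf; apply: continuous_compact_integrable; first exact: segment_compact.
exact: continuous_subspaceT.
Qed.

Lemma continuousX_fun f n : continuous f -> continuous (fun t => f t ^+ n).
Proof.
move=> cf t; elim: n => [|n IHn].
  by under eq_fun do rewrite expr0; exact: cvg_cst.
by under eq_fun do rewrite exprS; apply: cvgM; [exact: cf|exact: IHn].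
Qed.

Lemma measurable_norm_le (r : R) : measurable [set x : R | `|x| <= r].
Proof.
rewrite [X in measurable X](_ : _ = `[- r, r]%classic)//.
by apply/seteqP; split=> x /=; rewrite in_itv/= ler_norml.
Qed.

(** Subtracting the noise leaves [Y = b - N], which is differentiable even though [b] and [N] need
    not be. The energy identity [Y(T)^2 - b0^2 = - 2 c0 \int b^3 (b - N)] is then combined with the
    Young-type bound [b^3 (b - N) >= (b^4 - N^4) / 4]. *)
Lemma Rintegral_fourth_le b N (c0 b0 T : R) :
  0 < c0 -> 0 < T -> continuous b -> continuous N ->
  (forall t, 0 <= t <= T ->
     b t = b0 - c0 * Rintegral mu `[0, t] (fun s => b s ^+ 3) + N t) ->
  Rintegral mu `[0, T] (fun s => b s ^+ 4) <=
    2 * b0 ^+ 2 / c0 + Rintegral mu `[0, T] (fun s => N s ^+ 4).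
Proof.
move=> c0_gt0 T_gt0 cb cN eqb.
pose f t := - c0 * b t ^+ 3.
pose Y t := b0 + Rintegral mu `[0, t] f.
have cf : continuous f.
  by move=> t; apply: cvgM; [exact: cvg_cst|exact: continuousX_fun].
have fi x y : mu.-integrable `[x, y] (EFin \o f) by exact: continuous_itv_integrable.
have YE t : 0 <= t <= T -> Y t = b t - N t.
  move=> tT; rewrite eqb// addrK /Y /f RintegralZl ?mulNr//.
  exact/continuous_itv_integrable/continuousX_fun.
have dY : {in `]0, T[, forall t, derivable Y t 1 /\ Y^`()%classic t = f t}.
  move=> t; rewrite in_itv/= => /andP[t0 tT].
  have [df fE] := @continuous_FTC1_closed R f 0 t T tT (fi _ _) t0 (cf t).
  have -> : Y = cst b0 + (fun x => Rintegral mu `[0, x] f) by [].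
  split; first by apply: derivableD; [apply: derivable_cst|exact: df].
  rewrite derive1E deriveD; [|apply: derivable_cst|exact: df].
  by rewrite derive_cst add0r -derive1E fE.
have LR : derivable_oo_LRcontinuous Y 0 T.
  split; first by move=> t /dY[].
  - rewrite /Y set_itv1 Rintegral_set1.
    apply: cvgD; first exact: cvg_cst.
    by apply: cvg_at_right_filter; exact: (parameterized_integral_cvg_left T_gt0).
  - apply: cvgD; first exact: cvg_cst.
    exact: parameterized_integral_cvg_at_left.
have cfw : {within `[0, T], continuous f} by exact: continuous_subspaceT.
have dY' : {in `]0, T[, Y^`()%classic =1 f} by move=> t /dY[].
(* Integrating [Y] by parts against itself gives [2 I = Y(T)^2 - b0^2], where [I] is the integral of
   [Y f]. *)
have := Rintegration_by_parts T_gt0 cfw LR dY' cfw LR dY'.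
have -> : Y 0 = b0 by rewrite /Y set_itv1 Rintegral_set1 addr0.
under [X in _ - X]eq_Rintegral do rewrite mulrC.
set I := Rintegral _ _ _ => IE.
have b4i : mu.-integrable `[0, T] (EFin \o (fun t => b t ^+ 4)).
  exact/continuous_itv_integrable/continuousX_fun.
have N4i : mu.-integrable `[0, T] (EFin \o (fun t => N t ^+ 4)).
  exact/continuous_itv_integrable/continuousX_fun.
have : I <= - (c0 / 4) * (Rintegral mu `[0, T] (fun s => b s ^+ 4) -
                    Rintegral mu `[0, T] (fun s => N s ^+ 4)).
  have bNi k : mu.-integrable `[0, T] (EFin \o (fun t => k * (b t ^+ 4 - N t ^+ 4))).
    apply: continuous_itv_integrable => t; apply: cvgM; first exact: cvg_cst.
    by apply: cvgB; exact: continuousX_fun.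
  rewrite -RintegralB// -RintegralZl//; last first.
    by apply: continuous_itv_integrable => t; apply: cvgB; exact: continuousX_fun.
  apply: le_Rintegral => //.
  - apply: continuous_compact_integrable; first exact: segment_compact.
    move=> t; apply: continuousM; last exact: cfw.
    exact: (derivable_oo_LRcontinuous_within LR).
  - move=> t; rewrite /= in_itv/= => tT; rewrite YE//= /f.
    (* This product equals [3 b^4 - 4 b^3 N + N^4], that is, four times
       [b^3 (b - N) - (b^4 - N^4) / 4]. *)
    have : 0 <= (b t - N t) ^+ 2 * (2 * b t ^+ 2 + (b t + N t) ^+ 2).
      by rewrite mulr_ge0 ?sqr_ge0// addr_ge0 ?sqr_ge0// mulr_ge0 ?sqr_ge0.
    move=> /(mulr_ge0 (ltW c0_gt0)); lra.
have := sqr_ge0 (Y T).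
move: (Rintegral _ _ _) (Rintegral _ _ _) => B M Y2 IB.
rewrite -lerBlDr ler_pdivlMr//; lra.
Qed.

(** The equation reads [b0 + N = b + c0 \int b^3]. The first term is of order [theta] in mean square
    by assumption, the second is at most [theta * D] uniformly in time, and
    [(x + y)^2 <= 2 x^2 + 2 y^2] produces the constant [2 + 2 D^2]. *)
Lemma Rintegral_noise_sqr_le b N (c0 b0 T T0 M theta : R) :
  0 < c0 -> 0 < T <= T0 -> 0 < theta -> continuous b -> continuous N ->
  (forall t, 0 <= t <= T ->
     b t = b0 - c0 * Rintegral mu `[0, t] (fun s => b s ^+ 3) + N t) ->
  Rintegral mu `[0, T] (fun s => N s ^+ 4) <= M ->
  Rintegral mu `[0, T] (fun s => b s ^+ 2) <= theta ^+ 2 * T ->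
  Rintegral mu `[0, T] (fun s => (b0 + N s) ^+ 2) <=
    (2 + 2 * (c0 * (T0 + 2 * b0 ^+ 2 / c0 + M) / 2) ^+ 2) * theta ^+ 2 * T.
Proof.
move=> c0_gt0 /andP[T_gt0 TT0] th_gt0 cb cN eqb NM b2.
have b4 := Rintegral_fourth_le c0_gt0 T_gt0 cb cN eqb.
set D := c0 * _ / 2.
have bi n x y : mu.-integrable `[x, y] (EFin \o (fun t => b t ^+ n)).
  exact/continuous_itv_integrable/continuousX_fun.
(* [h] dominates [|b|^3] by the arithmetic-geometric inequality. The weights are balanced so that
   both integrals are of order [theta]: that of [b^2] is at most [theta^2 T], that of [b^4] is
   merely bounded. *)
pose h t := theta^-1 / 2 * b t ^+ 2 + theta / 2 * b t ^+ 4.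
have Zi k n x y : mu.-integrable `[x, y] (EFin \o (fun t => k * b t ^+ n)).
  apply: continuous_itv_integrable => t; apply: cvgM; first exact: cvg_cst.
  exact: continuousX_fun.
have hi x y : mu.-integrable `[x, y] (EFin \o h).
  apply: continuous_itv_integrable => t.
  by apply: cvgD; (apply: cvgM; [exact: cvg_cst|exact: continuousX_fun]).
have hge t : `|b t ^+ 3| <= h t.
  rewrite normrX -subr_ge0 /h -[b t ^+ 2]real_normK ?num_real//.
  have -> : b t ^+ 4 = `|b t| ^+ 4.
    by rewrite -normrX ger0_norm// (_ : b t ^+ 4 = (b t ^+ 2) ^+ 2) ?sqr_ge0// -exprM.
  set y := `|b t|.
  have -> : theta^-1 / 2 * y ^+ 2 + theta / 2 * y ^+ 4 - y ^+ 3 =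
      theta / 2 * y ^+ 2 * (theta^-1 - y) ^+ 2 by field; rewrite gt_eqF.
  by rewrite mulr_ge0 ?sqr_ge0// mulr_ge0 ?sqr_ge0// divr_ge0// ltW.
have hT : Rintegral mu `[0, T] h <=
    theta / 2 * (T0 + 2 * b0 ^+ 2 / c0 + M).
  rewrite RintegralD; [|by []|exact: Zi|exact: Zi].
  rewrite !RintegralZl //.
  have : theta^-1 / 2 * Rintegral mu `[0, T] (fun t => b t ^+ 2) <= theta / 2 * T.
    have -> : theta / 2 * T = theta^-1 / 2 * (theta ^+ 2 * T).
      by field; rewrite gt_eqF.
    by rewrite ler_wpM2l// divr_ge0// invr_ge0 ltW.
  have : theta / 2 * Rintegral mu `[0, T] (fun t => b t ^+ 4) <=
      theta / 2 * (2 * b0 ^+ 2 / c0 + M).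
    rewrite ler_wpM2l//; first by rewrite divr_ge0// ltW.
    by rewrite (le_trans b4)// lerD2l.
  have : theta / 2 * T <= theta / 2 * T0 by rewrite ler_wpM2l// divr_ge0// ltW.
  lra.
(* Since [h >= 0], its integral up to [T] controls all earlier times at once. *)
have bt t : 0 <= t <= T ->
    `|c0 * Rintegral mu `[0, t] (fun s => b s ^+ 3)| <= theta * D.
  move=> /andP[t0 tT].
  rewrite normrM (gtr0_norm c0_gt0).
  have -> : theta * D = c0 * (theta / 2 * (T0 + 2 * b0 ^+ 2 / c0 + M)).
    by rewrite /D; field; rewrite gt_eqF.
  rewrite ler_pM2l// (le_trans _ hT)// (le_trans (le_normr_Rintegral _ (bi _ _ _)))//.
  have bni : mu.-integrable `[0, t] (EFin \o (fun s => `|b s ^+ 3|)).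
    exact/integrable_norm/bi.
  apply: (@le_trans _ _ (Rintegral mu `[0, t] h)).
    by apply: le_Rintegral => // s _; exact: hge.
  rewrite -subr_ge0 Rintegral_itvB ?bnd_simp//.
  by apply: Rintegral_ge0 => s _; rewrite (le_trans _ (hge s)).
apply: (@le_trans _ _ (Rintegral mu `[0, T]
    (fun s => 2 * b s ^+ 2 + 2 * (theta * D) ^+ 2))).
  apply: le_Rintegral => //.
  - apply/continuous_itv_integrable/continuousX_fun => t.
    by apply: cvgD; [exact: cvg_cst|exact: cN].
  - apply: continuous_itv_integrable => t; apply: cvgD; last exact: cvg_cst.
    by apply: cvgM; [exact: cvg_cst|exact: continuousX_fun].
  - move=> s; rewrite /= in_itv/= => sT; have := bt s sT.
    rewrite ler_norml => /andP[]; have := eqb s sT.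
    set I := c0 * _ => bE I1 I2.
    have -> : b0 + N s = b s + I by rewrite bE; ring.
    have : 0 <= (theta * D - I) * (theta * D + I).
      by rewrite mulr_ge0 ?subr_ge0 // -lerBlDl sub0r.
    have := sqr_ge0 (b s - I); lra.
rewrite RintegralD; [|by []|exact: Zi|]; last first.
  by apply: continuous_itv_integrable => t; exact: cvg_cst.
rewrite RintegralZl; [|by []|exact: bi].
rewrite Rintegral_cst// /= lebesgue_measure_itv/= lte_fin T_gt0 oppr0 adde0/=.
move: b2; lra.
Qed.

(** Chebyshev's inequality in time: the indicator of [|g| <= 2 kappa] is at least
    [1 - g^2 / (4 kappa^2)], whose integral over [[T / 2, T]] is at least [T / 2 - T / 4]. The first
    half of the interval is dropped because the noise has vanishing variance near time 0. *)
Lemma occupation_ge g (kappa T : R) : 0 < kappa -> 0 < T -> continuous g ->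
  Rintegral mu `[0, T] (fun s => g s ^+ 2) <= kappa ^+ 2 * T ->
  T / 4 <= Rintegral mu `[T / 2, T] (fun s => \1_[set x | `|x| <= 2 * kappa] (g s)).
Proof.
move=> k_gt0 T_gt0 cg g2.
have gi x y : mu.-integrable `[x, y] (EFin \o (fun t => g t ^+ 2)).
  exact/continuous_itv_integrable/continuousX_fun.
have gT : Rintegral mu `[T / 2, T] (fun s => g s ^+ 2) <= kappa ^+ 2 * T.
  rewrite (le_trans _ g2)// -Rintegral_itv_obnd_cbnd//; last first.
    by apply: integrableS (gi (T / 2) T) => //; apply: subset_itvr; rewrite bnd_simp.
  rewrite -(Rintegral_itvB (gi 0 T)) ?bnd_simp; last 2 first.
  - lra.
  - lra.
  by rewrite gerBl; apply: Rintegral_ge0 => s _; exact: sqr_ge0.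
have ci : mu.-integrable `[T / 2, T] (EFin \o (fun=> 1%R)).
  by apply: continuous_itv_integrable => t; exact: cvg_cst.
have Zi : mu.-integrable `[T / 2, T]
    (EFin \o (fun s => (4 * kappa ^+ 2)^-1 * g s ^+ 2)).
  apply: continuous_itv_integrable => t; apply: cvgM; first exact: cvg_cst.
  exact: continuousX_fun.
apply: (@le_trans _ _ (Rintegral mu `[T / 2, T]
    (fun s => 1 - (4 * kappa ^+ 2)^-1 * g s ^+ 2))); last first.
  apply: le_Rintegral => //.
  - apply: continuous_itv_integrable => t; apply: cvgB; first exact: cvg_cst.
    by apply: cvgM; [exact: cvg_cst|exact: continuousX_fun].
  - apply: (@measurable_bounded_integrable _ _ _ mu) => //.
    + by rewrite /= lebesgue_measure_itv/=; case: ifP => // _; rewrite -EFinD ltry.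
    + apply: measurable_funTS; apply: measurableT_comp; last first.
        exact: continuous_measurable_fun.
      by apply: measurable_indic; exact: measurable_norm_le.
    + exists 1; split; first by rewrite num_real.
      by move=> x x1 s _ /=; rewrite indicE; case: (_ \in _); rewrite ?normr1 ?normr0 ltW// (lt_trans _ x1).
  - move=> s _; rewrite indicE; case: (boolP (g s \in _)) => [_|].
      by rewrite /= gerBl mulr_ge0 ?sqr_ge0// invr_ge0 mulr_ge0 ?sqr_ge0.
    rewrite notin_setE/= => /negP; rewrite -ltNge => kg.
    rewrite subr_le0 ler_pdivlMl ?mulr1; last by rewrite mulr_gt0 ?exprn_gt0.
    rewrite -[g s ^+ 2]real_normK ?num_real//.
    have : 0 <= (`|g s| - 2 * kappa) * (`|g s| + 2 * kappa).
      by rewrite mulr_ge0 ?subr_ge0 ?ltW// addr_gt0 ?mulr_gt0 // (lt_trans _ kg)// mulr_gt0.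
    lra.
rewrite RintegralB// Rintegral_cst// /= lebesgue_measure_itv/= lte_fin.
have -> : T / 2 < T by lra.
rewrite RintegralZl// -EFinD/=.
have : (4 * kappa ^+ 2)^-1 * Rintegral mu `[T / 2, T] (fun s => g s ^+ 2) <= T / 4.
  rewrite ler_pdivrMl; last by rewrite mulr_gt0 ?exprn_gt0.
  by move: gT; lra.
lra.
Qed.

End pathwise.

(** * Small balls and fourth moments of the normal law *)

Section gaussian.
Context {R : realType}.
Local Notation mu := (@lebesgue_measure R).

(** Change of variables holds with the Radon-Nikodym derivative, which agrees almost everywhere with
    [normal_pdf] because both have the same integral over every measurable set. *)
Lemma integral_normal_prob (m s : R) (f : R -> \bar R) :
  measurable_fun [set: R] f -> (forall x, 0 <= f x)%E ->
  (\int[normal_prob m s]_x f x = \int[mu]_x (f x * (normal_pdf m s x)%:E))%E.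
Proof.
move=> mf f0.
have dom := @normal_prob_dominates R m s.
rewrite -(Radon_Nikodym_SigmaFinite.change_of_variables dom)//.
apply: ae_eq_integral => //.
- apply: emeasurable_funM => //.
  exact: measurable_int (Radon_Nikodym_SigmaFinite.f_integrable dom).
- apply: emeasurable_funM => //.
  by apply/measurable_EFinP; exact: measurable_normal_pdf.
- apply: ae_eqe_mul2l; apply: integral_ae_eq => //.
  + exact: Radon_Nikodym_SigmaFinite.f_integrable.
  + by apply/measurable_EFinP; exact: measurable_normal_pdf.
  + by move=> A _ mA; rewrite -Radon_Nikodym_SigmaFinite.f_integral.
Qed.

(** An interval of length [2 r] is weighed against the maximum of the density, which is at most
    [1 / (2 s)] because [pi >= 2]. *)
Lemma normal_prob_ball_le (m s x r : R) : 0 < s -> 0 <= r ->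
  (normal_prob m s [set y | `|x + y| <= r]%R <= (r / s)%:E)%E.
Proof.
move=> s_gt0 r_ge0.
have -> : [set y | `|x + y| <= r]%R = `[- x - r, - x + r]%classic.
  apply/seteqP; split=> y /=; rewrite in_itv/= ler_norml => /andP[? ?]; apply/andP; split; lra.
rewrite /normal_prob.
apply: (@le_trans _ _ (\int[mu]_(y in `[(- x - r)%R, (- x + r)%R]) (normal_peak s)%:E)%E).
  apply: ge0_le_integral => //.
  - by move=> y _; rewrite lee_fin normal_pdf_ge0.
  - by apply/measurable_EFinP/measurable_funTS; exact: measurable_normal_pdf.
  - by move=> y _; rewrite lee_fin normal_pdf_ub// gt_eqF.
rewrite integral_cst//= lebesgue_measure_itv/= lte_fin.
case: ifPn => [xr|_]; last by rewrite mule0 lee_fin divr_ge0// ltW.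
rewrite -EFinD -EFinM lee_fin.
have -> : - x + r - (- x - r) = 2 * r by ring.
have sp : 2 * s <= Num.sqrt (s ^+ 2 * pi *+ 2).
  rewrite -[leLHS]gtr0_norm ?mulr_gt0// -sqrtr_sqr ler_wsqrtr//.
  have := ler_wpM2l (sqr_ge0 s) (@pi_ge2 R).
  by rewrite exprMn -mulr_natr; lra.
rewrite /normal_peak mulrC -mulrA mulrCA ler_wpM2l//.
rewrite ler_pdivrMr ?(lt_le_trans _ sp) ?mulr_gt0// ler_pdivlMl//.
by rewrite mulrC.
Qed.

Lemma normal_prob_fourth_moment_le (m s : R) : 0 < s ->
  (\int[normal_prob m s]_x ((x - m) ^+ 4)%:E <= (32 * s ^+ 4)%:E)%E.
Proof.
move=> s_gt0.
have s_neq0 : s != 0 by rewrite gt_eqF.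
have s2_neq0 : 2 * s != 0 by rewrite gt_eqF// mulr_gt0.
have mX : measurable_fun [set: R] (fun x : R => ((x - m) ^+ 4)%:E).
  by apply/measurable_EFinP; apply: measurable_funX; exact: measurable_funB.
have p4 (y : R) : 0 <= y ^+ 4 by exact: exprn_even_ge0.
rewrite integral_normal_prob//; last by move=> x; rewrite lee_fin.
(* (x - m)^4 times the density with deviation s is at most 32 s^4 times the
   density with deviation 2 s. *)
have -> : (32 * s ^+ 4)%:E =
    (\int[mu]_x ((32 * s ^+ 4)%:E * (normal_pdf m (2 * s) x)%:E))%E.
  rewrite ge0_integralZl ?integral_normal_pdf ?mule1//.
  - by apply/measurable_EFinP; exact: measurable_normal_pdf.
  - by move=> x _; rewrite lee_fin normal_pdf_ge0.
  - by rewrite lee_fin mulr_ge0 ?p4.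
apply: ge0_le_integral => //.
- by move=> x _; rewrite mule_ge0 ?lee_fin ?normal_pdf_ge0.
- by apply: emeasurable_funM => //; apply/measurable_EFinP; exact: measurable_normal_pdf.
- by apply: emeasurable_funM => //; apply/measurable_EFinP; exact: measurable_normal_pdf.
move=> x _; rewrite -!EFinM lee_fin !normal_pdfE// /normal_fun.
have -> : normal_peak (2 * s) = normal_peak s / 2.
  rewrite /normal_peak -invfM; congr (_^-1).
  have -> : (2 * s) ^+ 2 * pi *+ 2 = 2 ^+ 2 * (s ^+ 2 * pi *+ 2).
    by ring.
  by rewrite sqrtrM ?sqr_ge0// sqrtr_sqr ger0_norm// mulrC.
(* In this variable the two Gaussian exponents are [- 4 u] and [- u], and the comparison reduces to
   [u^2 exp(- 3 u) <= 1 / 4], which follows from [exp(3 u) >= 1 + (3 u)^2 / 2]. *)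
set u := (x - m) ^+ 2 / (8 * s ^+ 2).
have u_ge0 : 0 <= u by rewrite divr_ge0 ?sqr_ge0// mulr_ge0 ?sqr_ge0.
have -> : - (x - m) ^+ 2 / (s ^+ 2 *+ 2) = - (3 * u) - u.
  by rewrite /u; field.
have -> : - (x - m) ^+ 2 / ((2 * s) ^+ 2 *+ 2) = - u.
  by rewrite /u; field.
have -> : (x - m) ^+ 4 = 64 * s ^+ 4 * u ^+ 2.
  by rewrite /u; field.
rewrite expRD.
have e3 : u ^+ 2 * expR (- (3 * u)) <= 1 / 4.
  rewrite expRN ler_pdivrMr ?expR_gt0//.
  have := @expR_ge1Dxn R (3 * u) 1; rewrite mulr_ge0// => /(_ isT).
  by rewrite exprMn; have := sqr_ge0 u; rewrite (_ : 2`! = 2)//; lra.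
have : 0 <= s ^+ 4 * normal_peak s * expR (- u).
  by rewrite mulr_ge0 ?expR_ge0// mulr_ge0 ?p4// normal_peak_ge0.
move: e3; set e := expR (- (3 * u)); set e' := expR (- u); set k := normal_peak s.
move=> e3 K_ge0; have {}e3 : 0 <= 1 / 4 - u ^+ 2 * e by rewrite subr_ge0.
by have := mulr_ge0 K_ge0 e3; lra.
Qed.

End gaussian.

(** * Small balls and fourth moments of centred Gaussian variables *)

Lemma integrable_of_sqr d (Om : measurableType d) (R : realType)
    (P : probability Om R) (Z : Om -> R) (v : R) :
  measurable_fun [set: Om] Z -> (\int[P]_w (Z w ^+ 2)%:E = v%:E)%E ->
  P.-integrable [set: Om] (fun w => (Z w)%:E).
Proof.
move=> mZ VZ.
apply: (@le_integrable _ _ _ _ _ _ _ (fun w => (1%:E + (Z w ^+ 2)%:E)%E)) => //.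
- exact/measurable_EFinP.
- move=> w _; rewrite lee_fin [leRHS]ger0_norm ?addr_ge0 ?sqr_ge0//.
  rewrite ler_norml; have := sqr_ge0 (Z w - 1); have := sqr_ge0 (Z w + 1).
  by have := sqr_ge0 (Z w) => h1 h2 h3; apply/andP; split; lra.
- apply: integrableD => //; apply/integrableP; split => //.
  + under eq_integral do rewrite gee0_abs ?lee_fin//.
    by rewrite integral_cst//= probability_setT mule1 ltry.
  + by apply/measurable_EFinP; exact: measurable_funX.
  + under eq_integral do rewrite gee0_abs ?lee_fin ?sqr_ge0//.
    by rewrite VZ ltry.
Qed.

Section centered_gaussian.
Context {d : measure_display} {Om : measurableType d} {R : realType}.
Variables (P : probability Om R) (Z : Om -> R) (v : R).
Hypothesis mZ : measurable_fun [set: Om] Z.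
Hypothesis gZ : gaussian_rv P Z.
Hypothesis EZ : (\int[P]_w (Z w)%:E = 0)%E.
Hypothesis VZ : (\int[P]_w (Z w ^+ 2)%:E = v%:E)%E.

Let law (m s : R) :
  (forall A : set R, measurable A -> P (Z @^-1` A) = normal_prob m s A) ->
  forall f : R -> \bar R, measurable_fun [set: R] f -> (forall x, 0 <= f x)%E ->
  (\int[P]_w f (Z w) = \int[normal_prob m s]_x f x)%E.
Proof.
move=> PZ f mf f0.
have mZ' : measurable_fun [set: Om] (Z : Om -> measurableTypeR R) := mZ.
pose Z' : {mfun Om >-> measurableTypeR R} := HB.pack Z (isMeasurableFun.Build _ _ _ _ _ mZ').
transitivity (\int[distribution P Z']_x f x)%E.
  by rewrite ge0_integral_distribution.
by apply: eq_measure_integral => A mA _; exact: PZ.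
Qed.

Let integral_P_cst (k : R) : (\int[P]_w k%:E = k%:E)%E.
Proof. by rewrite integral_cst//= probability_setT mule1. Qed.

Let mZX n : measurable_fun [set: Om] (fun w => (Z w ^+ n)%:E).
Proof. by apply/measurable_EFinP; exact: measurable_funX. Qed.

Let integrableZ2 : P.-integrable [set: Om] (fun w => (Z w ^+ 2)%:E).
Proof.
apply/integrableP; split; first exact: mZX.
under eq_integral do rewrite gee0_abs ?lee_fin ?sqr_ge0//.
by rewrite VZ ltry.
Qed.

(** Comparing the parameters of the law with the moments of [Z] up to constants avoids computing the
    moments of [normal_prob]. For the lower bound on [v], the ball of radius [s / 2] has probability
    at most [1 / 2]. For the upper bounds, [E (Z - m)^2 = v + m^2] is controlled by the fourth
    moment. *)
Let normal_parameters (m s : R) : 0 < s ->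
  (forall A : set R, measurable A -> P (Z @^-1` A) = normal_prob m s A) ->
  [/\ s ^+ 2 <= 8 * v, v <= 25 * s ^+ 2 & m ^+ 2 <= 25 * s ^+ 2].
Proof.
move=> s_gt0 PZ.
have p4 (y : R) : 0 <= y ^+ 4 by exact: exprn_even_ge0.
have lb : s ^+ 2 <= 8 * v.
  pose A := [set y : R | `|0 + y| <= s / 2].
  have mA : measurable A.
    rewrite [X in measurable X](_ : _ = `[- (s / 2), s / 2]%classic)//.
    by apply/seteqP; split=> x; rewrite /A/= in_itv/= add0r ler_norml.
  have mZA : measurable (Z @^-1` A) by rewrite -[X in measurable X]setTI; exact: mZ.
  have PA : (P (Z @^-1` A) <= (1 / 2)%:E)%E.
    have s2 : 0 <= s / 2 by rewrite divr_ge0// ltW.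
    rewrite PZ// (le_trans (normal_prob_ball_le m 0 s_gt0 s2))//.
    by rewrite lee_fin mulrAC divff ?gt_eqF.
  (* Outside [A] one has [Z^2 >= s^2 / 4]. Taking expectations gives [s^2 / 4 <= v + s^2 / 8]. *)
  have : ((s ^+ 2 / 4)%:E <=
      \int[P]_w ((Z w ^+ 2)%:E + (s ^+ 2 / 4)%:E * (\1_(Z @^-1` A) w)%:E))%E.
    rewrite -[leLHS]integral_P_cst; apply: ge0_le_integral => //.
    - by move=> w _; rewrite lee_fin divr_ge0 ?sqr_ge0.
    - apply: emeasurable_funD; first exact: mZX.
      by apply: emeasurable_funM => //; apply/measurable_EFinP; exact: measurable_indic.
    - move=> w _; rewrite -EFinM -EFinD lee_fin indicE.
      case: (boolP (w \in _)) => [_|]; first by rewrite mulr1 lerDr sqr_ge0.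
      rewrite notin_setE /A/= add0r => /negP; rewrite -ltNge mulr0 addr0 => sZ.
      rewrite -[Z w ^+ 2]real_normK ?num_real//.
      have : 0 <= (`|Z w| - s / 2) * (`|Z w| + s / 2).
        by rewrite mulr_ge0 ?subr_ge0 ?(ltW sZ)// addr_ge0// divr_ge0// ltW.
      lra.
  rewrite ge0_integralD//; last 3 first.
  - by move=> w _; rewrite lee_fin sqr_ge0.
  - by move=> w _; rewrite -EFinM lee_fin mulr_ge0// divr_ge0 ?sqr_ge0.
  - by apply: emeasurable_funM => //; apply/measurable_EFinP; exact: measurable_indic.
  rewrite VZ ge0_integralZl//; last 2 first.
  - by apply/measurable_EFinP; exact: measurable_indic.
  - by rewrite lee_fin divr_ge0 ?sqr_ge0.
  rewrite integral_indic// setIT => /le_trans - /(_ (v + s ^+ 2 / 4 * (1 / 2))%:E).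
  rewrite lee_fin => H; suff : s ^+ 2 / 4 <= v + s ^+ 2 / 4 * (1 / 2) by lra.
  apply: H; rewrite EFinD (EFinM (s ^+ 2 / 4) (1 / 2)); apply: leeD2l; apply: lee_wpmul2l => //.
  by rewrite lee_fin divr_ge0 ?sqr_ge0.
have mZm n : measurable_fun [set: Om] (fun w => ((Z w - m) ^+ n)%:E).
  by apply/measurable_EFinP; apply: measurable_funX; exact: measurable_funB.
have var : (\int[P]_w ((Z w - m) ^+ 2)%:E = (v + m ^+ 2)%:E)%E.
  under eq_integral => w _.
    rewrite (_ : ((Z w - m) ^+ 2)%:E =
      ((Z w ^+ 2)%:E + ((- (2 * m))%:E * (Z w)%:E + (m ^+ 2)%:E))%E); last first.
      by rewrite -EFinM -!EFinD; congr EFin; ring.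
    over.
  have integrableZ := integrable_of_sqr mZ VZ.
  have iZ : P.-integrable [set: Om] (fun w => (- (2 * m))%:E * (Z w)%:E)%E.
    exact: integrableZl.
  have im : P.-integrable [set: Om] (fun w => (m ^+ 2)%:E).
    apply/integrableP; split => //.
    by under eq_integral do rewrite gee0_abs ?lee_fin ?sqr_ge0//; rewrite integral_P_cst ltry.
  rewrite integralD//; last exact: integrableD.
  by rewrite integralD// integralZl// EZ mule0 add0e VZ integral_P_cst.
have ub : v + m ^+ 2 <= 17 * s ^+ 2.
  rewrite -lee_fin -var.
  (* With [y = Z - m], the bound [y^2 <= y^4 / (2 s^2) + s^2 / 2] and the fourth moment [32 s^4]
     give [16 s^2 + s^2 / 2]. *)
  apply: (@le_trans _ _ (\int[P]_w
     ((2 * s ^+ 2)^-1%:E * ((Z w - m) ^+ 4)%:E + (s ^+ 2 / 2)%:E))%E).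
    apply: ge0_le_integral => //.
    - by move=> w _; rewrite lee_fin sqr_ge0.
    - by apply: emeasurable_funD => //; apply: emeasurable_funM.
    - move=> w _; rewrite -EFinM -EFinD lee_fin; set y := Z w - m.
      rewrite -subr_ge0.
      have -> : (2 * s ^+ 2)^-1 * y ^+ 4 + s ^+ 2 / 2 - y ^+ 2 =
          (y ^+ 2 - s ^+ 2) ^+ 2 / (2 * s ^+ 2) by field; rewrite gt_eqF.
      by rewrite divr_ge0 ?sqr_ge0// mulr_ge0 ?sqr_ge0.
  have k0 : 0 <= (2 * s ^+ 2)^-1 by rewrite invr_ge0 mulr_ge0 ?sqr_ge0.
  rewrite ge0_integralD//; last 3 first.
  - by move=> w _; rewrite -EFinM lee_fin mulr_ge0.
  - by apply: emeasurable_funM.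
  - by move=> w _; rewrite lee_fin divr_ge0 ?sqr_ge0.
  rewrite ge0_integralZl//; last by move=> w _; rewrite lee_fin.
  rewrite integral_P_cst.
  rewrite (law PZ (f := fun x => ((x - m) ^+ 4)%:E)); last 2 first.
  - by apply/measurable_EFinP; apply: measurable_funX; exact: measurable_funB.
  - by move=> x; rewrite lee_fin.
  apply: (@le_trans _ _ ((2 * s ^+ 2)^-1%:E * (32 * s ^+ 4)%:E + (s ^+ 2 / 2)%:E)%E).
    by apply: leeD2r; apply: lee_wpmul2l => //; exact: normal_prob_fourth_moment_le.
  rewrite -EFinM -EFinD lee_fin.
  have -> : (2 * s ^+ 2)^-1 * (32 * s ^+ 4) = 16 * s ^+ 2 by field; rewrite gt_eqF.
  by have := sqr_ge0 s; lra.
by split=> //; have := sqr_ge0 m; have := sqr_ge0 s; lra.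
Qed.

Let degenerate (m : R) : {ae P, forall w, Z w = m} -> m = 0 /\ v = 0.
Proof.
move=> Zm.
have m0 : m = 0.
  suff : (m%:E = 0)%E by case.
  rewrite -EZ -[LHS]integral_P_cst; apply: ae_eq_integral => //; first exact/measurable_EFinP.
  by apply: filterS Zm => w ->.
split=> //; apply: EFin_inj; rewrite -VZ -[RHS]integral_P_cst; apply: ae_eq_integral => //.
by apply: filterS Zm => w -> _; rewrite m0 expr0n.
Qed.

(** Positive variance excludes a point mass, and [v <= 25 s^2] turns the normal bound [r / s] into
    one with [5 / sqrt v]. *)
Lemma gaussian_ball_le (x r : R) : 0 < v -> 0 <= r ->
  (P [set w | `|x + Z w| <= r]%R <= (5 * r / Num.sqrt v)%:E)%E.
Proof.
move=> v_gt0 r_ge0; case: gZ => [[m /degenerate[_ v0]]|[m [s [s_gt0 PZ]]]].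
  by rewrite v0 ltxx in v_gt0.
have [_ vs _] := normal_parameters s_gt0 PZ.
rewrite [X in P X](_ : _ = Z @^-1` [set y | `|x + y| <= r])// PZ; last first.
  rewrite [X in measurable X](_ : _ = `[- x - r, - x + r]%classic)//.
  by apply/seteqP; split=> y /=; rewrite in_itv/= ler_norml => /andP[? ?]; apply/andP; split; lra.
rewrite (le_trans (normal_prob_ball_le m x s_gt0 r_ge0))// lee_fin.
have sv : Num.sqrt v <= 5 * s.
  rewrite -[leRHS]gtr0_norm ?mulr_gt0// -sqrtr_sqr ler_wsqrtr//.
  by rewrite exprMn; lra.
rewrite ler_pdivrMr// mulrAC ler_pdivlMr ?sqrtr_gt0//.
by rewrite mulrC [leRHS]mulrC mulrA ler_wpM2r// mulrC.
Qed.

Lemma gaussian_fourth_moment_le :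
  (\int[P]_w (Z w ^+ 4)%:E <= (600 * 600 * v ^+ 2)%:E)%E.
Proof.
have p4 (y : R) : 0 <= y ^+ 4 by exact: exprn_even_ge0.
case: gZ => [[m Zm]|[m [s [s_gt0 PZ]]]].
  have [m0 _] := degenerate Zm.
  rewrite (_ : integral _ _ _ = 0%E); first by rewrite lee_fin mulr_ge0 ?sqr_ge0.
  rewrite -[RHS]integral_P_cst; apply: ae_eq_integral => //.
  by apply: filterS Zm => w -> _; rewrite m0 expr0n.
have [sv _ ms] := normal_parameters s_gt0 PZ.
have mZm : measurable_fun [set: Om] (fun w => ((Z w - m) ^+ 4)%:E).
  by apply/measurable_EFinP; apply: measurable_funX; exact: measurable_funB.
(* Convexity of the fourth power moves the centre to [m]. Then [8 * 32 s^4 + 8 * 625 s^4] with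
   [s^4 <= 64 v^2] stays below [600^2 v^2]. *)
apply: (@le_trans _ _ (\int[P]_w (8%:E * ((Z w - m) ^+ 4)%:E + (8 * m ^+ 4)%:E))%E).
  apply: ge0_le_integral => //.
  - by move=> w _; rewrite lee_fin.
  - by apply: emeasurable_funD => //; apply: emeasurable_funM.
  - move=> w _; rewrite -EFinM -EFinD lee_fin.
    rewrite -{1}(subrK m (Z w)); move: (Z w - m) => y.
    have : 0 <= (y - m) ^+ 2 * (5 * (y + m) ^+ 2 + 2 * y ^+ 2 + 2 * m ^+ 2).
      by rewrite mulr_ge0 ?sqr_ge0// !addr_ge0// mulr_ge0 ?sqr_ge0.
    lra.
rewrite ge0_integralD//; last 3 first.
- by move=> w _; rewrite -EFinM lee_fin mulr_ge0.
- by apply: emeasurable_funM.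
- by move=> w _; rewrite lee_fin mulr_ge0.
rewrite ge0_integralZl//; last by move=> w _; rewrite lee_fin.
rewrite integral_P_cst.
rewrite (law PZ (f := fun x => ((x - m) ^+ 4)%:E)); last 2 first.
- by apply/measurable_EFinP; apply: measurable_funX; exact: measurable_funB.
- by move=> x; rewrite lee_fin.
apply: (@le_trans _ _ (8%:E * (32 * s ^+ 4)%:E + (8 * m ^+ 4)%:E)%E).
  by apply: leeD2r; apply: lee_wpmul2l => //; exact: normal_prob_fourth_moment_le.
rewrite -EFinM -EFinD lee_fin.
have : m ^+ 4 <= 625 * s ^+ 4.
  have : 0 <= (25 * s ^+ 2 - m ^+ 2) * (25 * s ^+ 2 + m ^+ 2).
    by rewrite mulr_ge0 ?subr_ge0// addr_ge0 ?sqr_ge0// mulr_ge0 ?sqr_ge0.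
  lra.
have : s ^+ 4 <= 64 * v ^+ 2.
  have : 0 <= (8 * v - s ^+ 2) * (8 * v + s ^+ 2).
    by rewrite mulr_ge0 ?subr_ge0// addr_ge0 ?sqr_ge0// (le_trans _ sv) ?sqr_ge0.
  lra.
have := sqr_ge0 v; lra.
Qed.

End centered_gaussian.

(** * Joint measurability and time integrals of continuous processes *)

Section continuous_processes.
Context {d : measure_display} {Om : measurableType d} {R : realType}.
Local Notation mu := (@lebesgue_measure R).
Local Notation RT := (measurableTypeR R).

(** Freezing a path outside [[0, T0]] makes it continuous on the whole line, as the pathwise and
    measurability lemmas require. *)
Lemma continuous_clip (f : R -> R) (T0 : R) : 0 <= T0 ->
  {within `[0, T0], continuous f} ->
  continuous (fun t => f (Num.max 0 (Num.min t T0))).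
Proof.
move=> T0_ge0 /subspace_continuousP cf t.
have cl (s : R) : `[0, T0]%classic (Num.max 0 (Num.min s T0)).
  by rewrite /= in_itv/= le_max lexx/= ge_max T0_ge0 ge_min lexx orbT.
have cc : (fun s : R => Num.max 0 (Num.min s T0)) s @[s --> t] -->
    Num.max 0 (Num.min t T0).
  apply: (@continuous_max R R (cst 0) (fun s => Num.min s T0)).
    exact: cvg_cst.
  by apply: (@continuous_min R R id (cst T0)); [exact: cvg_id|exact: cvg_cst].
move=> A /(cf _ (cl t)) /cc; apply: (@filterS _ (nbhs t)) => s.
by apply; exact: cl.
Qed.

(* [f] is the pointwise limit of the discretizations [f (floor (n t) / n) w]. *)
Lemma measurable_fun_continuous_section (f : R -> Om -> R) :
  (forall t, measurable_fun [set: Om] (f t)) ->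
  (forall w, continuous (f ^~ w)) ->
  measurable_fun [set: RT * Om] (fun z => f z.1 z.2).
Proof.
move=> mf cf.
pose h n (z : RT * Om) := f ((Num.floor (z.1 * n.+1%:R))%:~R / n.+1%:R) z.2.
apply: (@measurable_fun_cvg _ _ _ _ h) => [n _ A mA|[t w] _].
  rewrite setTI.
  (* On each cell of mesh [1 / (n + 1)] the discretization does not depend on time, so the preimage
     is a countable union of rectangles. *)
  have -> : h n @^-1` A = \bigcup_(k : int)
      (`[k%:~R / n.+1%:R, (k + 1)%:~R / n.+1%:R[%classic `*`
       (f (k%:~R / n.+1%:R) @^-1` A)).
    apply/seteqP; split=> [[t w]/= Ah|[t w] [k _ [/=]]].
      exists (Num.floor (t * n.+1%:R)) => //; split => //=.
      by rewrite in_itv/= ler_pdivrMr// ltr_pdivlMr// floor_itv.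
    rewrite in_itv/= ler_pdivrMr// ltr_pdivlMr// => /floor_def.
    by rewrite /h/= => ->.
  apply: countable_bigcupT_measurable => // k.
  apply: measurableX; first exact: measurable_itv.
  by rewrite -[X in measurable X]setTI; exact: mf.
apply: (@cvg_comp _ _ _
   (fun n => (Num.floor (t * n.+1%:R))%:~R / n.+1%:R) (f ^~ w) _ (nbhs t)); last exact: cf.
apply/cvgrPdist_le => e e0; near=> n.
have n0 : 0 < n.+1%:R :> R by [].
have /andP[fl fu] := floor_itv (t * n.+1%:R).
have ne : n.+1%:R^-1 <= e.
  apply/ltW; near: n; exact: (near_infty_natSinv_lt (PosNum e0)).
rewrite ger0_norm; last by rewrite subr_ge0 ler_pdivrMr.
rewrite (le_trans _ ne)// lerBlDr -[X in X + _]mul1r -mulrDl.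
rewrite ler_pdivlMr// ltW// (lt_le_trans fu)// intrD; lra.
Unshelve. all: by end_near. Qed.

(** Tonelli's theorem applies to the positive and negative parts of [F], with [D] absorbed as an
    indicator. *)
Lemma measurable_integral_section (D : set RT) (F : RT * Om -> \bar R) :
  measurable D -> measurable_fun [set: RT * Om] F ->
  measurable_fun [set: Om] (fun w => \int[mu]_(t in D) F (t, w))%E.
Proof.
move=> mD mF.
have mF' (G : RT * Om -> \bar R) : measurable_fun [set: RT * Om] G ->
    (forall z, 0 <= G z)%E ->
    measurable_fun [set: Om] (fun w => \int[mu]_(t in D) G (t, w))%E.
  move=> mG G0.
  have mDG : measurable_fun [set: RT * Om] (fun z => (\1_D z.1)%:E * G z)%E.
    apply: emeasurable_funM => //; apply/measurable_EFinP.
    by apply: measurableT_comp; [exact: measurable_indic|exact: measurable_fst].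
  have DG0 z : (0 <= (\1_D z.1)%:E * G z)%E by rewrite mule_ge0.
  have := measurable_fun_fubini_tonelli_G (m1 := mu) _ mDG DG0.
  congr (measurable_fun _ _); apply/funext => w; rewrite /fubini_G [RHS]integral_mkcond.
  apply: eq_integral => t _; rewrite patchE indicE /=.
  by case: (_ \in _); rewrite ?mul1e ?mul0e.
under eq_fun do rewrite integralE.
apply: emeasurable_funB.
- rewrite (_ : (fun w => _) = (fun w => \int[mu]_(t in D) F^\+ (t, w))%E).
    apply: mF'; first exact: measurable_funepos.
    by move=> z; exact: funepos_ge0.
  by apply/funext => w; apply: eq_integral => t _; rewrite !funeposE.
- rewrite (_ : (fun w => _) = (fun w => \int[mu]_(t in D) F^\- (t, w))%E).
    apply: mF'; first exact: measurable_funeneg.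
    by move=> z; exact: funeneg_ge0.
  by apply/funext => w; apply: eq_integral => t _; rewrite !funenegE.
Qed.

Lemma measurable_Rintegral_section (D : set RT) (F : RT * Om -> R) :
  measurable D -> measurable_fun [set: RT * Om] F ->
  measurable_fun [set: Om] (fun w => Rintegral mu D (fun t => F (t, w))).
Proof.
move=> mD mF; apply: (measurableT_comp (f := fine)) => //.
apply: (measurable_integral_section (F := fun z => (F z)%:E)) => //.
exact/measurable_EFinP.
Qed.

(** Markov's inequality for the time integral, whose expectation is at most [K] times the length of
    [D] by Tonelli. *)
Lemma markov_integral_section (P : probability Om R) (D : set RT)
    (F : RT * Om -> R) (K a : R) :
  measurable D -> measurable_fun [set: RT * Om] F -> (forall z, 0 <= F z) ->
  0 < a -> (forall t, D t -> \int[P]_w (F (t, w))%:E <= K%:E)%E ->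
  (a%:E * P [set w | a%:E <= \int[mu]_(t in D) (F (t, w))%:E] <= K%:E * mu D)%E.
Proof.
move=> mD mF F0 a_gt0 FK.
have mEF : measurable_fun [set: RT * Om] (fun z => (F z)%:E).
  exact/measurable_EFinP.
pose G w := (\int[mu]_(t in D) (F (t, w))%:E)%E.
have mG : measurable_fun [set: Om] G.
  exact: (measurable_integral_section mD mEF).
have G0 w : (0 <= G w)%E by apply: integral_ge0 => t _; rewrite lee_fin.
have mA : measurable [set w | a%:E <= G w]%E.
  by rewrite -[X in measurable X]setTI; exact: emeasurable_fun_c_infty.
apply: (@le_trans _ _ (\int[P]_w G w)%E).
  rewrite -[X in P X]setIT -integral_indic// -ge0_integralZl//; last 2 first.
  - by apply/measurable_EFinP; exact: measurable_indic.
  - by rewrite lee_fin ltW.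
  apply: ge0_le_integral => //.
  - by move=> w _; rewrite mule_ge0// lee_fin ltW.
  - by apply: emeasurable_funM => //; apply/measurable_EFinP; exact: measurable_indic.
  - move=> w _; rewrite indicE; case: (boolP (w \in _)) => [|_].
      by rewrite inE/= mule1.
    by rewrite mule0.
pose E z := ((\1_D z.1)%:E * (F z)%:E)%E.
have mE : measurable_fun [set: RT * Om] E.
  apply: emeasurable_funM => //; apply/measurable_EFinP.
  by apply: measurableT_comp; [exact: measurable_indic|exact: measurable_fst].
have E0 z : (0 <= E z)%E by rewrite mule_ge0// lee_fin.
have -> : (\int[P]_w G w = \int[P]_w \int[mu]_t E (t, w))%E.
  apply: eq_integral => w _; rewrite /G integral_mkcond.
  apply: eq_integral => t _; rewrite patchE /E indicE /=.
  by case: (_ \in _); rewrite ?mul1e ?mul0e.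
rewrite -(fubini_tonelli E mE E0).
rewrite -[X in mu X]setIT -integral_indic//.
(* The sign of [K] can be read off from the moment bound only at some point of [D], hence the
   separate case of an empty [D]. *)
have [D0|/set0P[t0 Dt0]] := eqVneq D set0.
  rewrite D0 (_ : integral _ _ _ = 0%E); first by rewrite indic0 integral0 mule0.
  apply: integral0_eq => t _; rewrite integral0_eq// => w _.
  by rewrite /E D0 indic0 mul0e.
have K0 : (0 <= K%:E)%E.
  by rewrite (le_trans _ (FK t0 Dt0))//; apply: integral_ge0 => w _; rewrite lee_fin.
rewrite -ge0_integralZl//; last by apply/measurable_EFinP; exact: measurable_indic.
apply: ge0_le_integral => //.
- by move=> t _; exact: integral_ge0.
- exact: (measurable_fun_fubini_tonelli_F (m2 := P) E mE E0).
- by apply: emeasurable_funM => //; apply/measurable_EFinP; exact: measurable_indic.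
- move=> t _; rewrite /E/= indicE; case: (boolP (t \in D)) => [|_].
    rewrite inE mule1 => /FK; congr (_ <= _)%E.
    by apply: eq_integral => w _; rewrite mul1e.
  by rewrite mule0 integral0_eq// => w _; rewrite mul0e.
Qed.

End continuous_processes.

(** * Probability that the path has small energy *)

Section small_energy.
Context {d : measure_display} {Om : measurableType d} {R : realType}.
Variable P : probability Om R.
Local Notation mu := (@lebesgue_measure R).
Local Notation RT := (measurableTypeR R).

Lemma measurable_small_energy (b : R -> Om -> R) (T k : R) :
  (forall t, measurable_fun [set: Om] (b t)) -> (forall w, continuous (b ^~ w)) ->
  measurable [set w | Rintegral mu `[0, T] (fun s => b s w ^+ 2) <= k].
Proof.
move=> mb cb.
have mF : measurable_fun [set: RT * Om] (fun z => b z.1 z.2 ^+ 2).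
  by apply: measurable_funX; exact: measurable_fun_continuous_section.
have mI := measurable_Rintegral_section (measurable_itv `[0, T]) mF.
rewrite [X in measurable X](_ : _ =
  (fun w => Rintegral mu `[0, T] (fun s => b s w ^+ 2)) @^-1` `]-oo, k]).
  by rewrite -[X in measurable X]setTI; exact: mI.
by apply/seteqP; split=> w /=; rewrite in_itv/=.
Qed.

(** Small energy forces one of two rare events. Either [\int N^4 >= M], of probability at most
    [K T / M], or [b0 + N] spends time at least [T / 4] in the ball of radius [r = 2 kappa theta].
    The expected time there is at most [r S T / 2], so the second event has probability at most
    [2 r S]. *)
Lemma small_energy_prob_le (b N : R -> Om -> R) (b0 c0 T T0 K M S theta : R) :
  (forall t, measurable_fun [set: Om] (b t)) -> (forall w, continuous (b ^~ w)) ->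
  (forall t, measurable_fun [set: Om] (N t)) -> (forall w, continuous (N ^~ w)) ->
  0 < c0 -> 0 < T <= T0 -> 0 < M -> 0 < theta ->
  (forall w t, 0 <= t <= T ->
     b t w = b0 - c0 * Rintegral mu `[0, t] (fun s => b s w ^+ 3) + N t w) ->
  (forall t, 0 <= t <= T -> (\int[P]_w (N t w ^+ 4)%:E <= K%:E)%E) ->
  (forall t r, T / 2 <= t <= T -> 0 <= r ->
     (P [set w | `|b0 + N t w| <= r]%R <= (r * S)%:E)%E) ->
  (P [set w | Rintegral mu `[0, T] (fun s => b s w ^+ 2) <= theta ^+ 2 * T]%R <=
   (K * T0 / M + 4 * S * (2 + c0 * (T0 + 2 * b0 ^+ 2 / c0 + M)) * theta)%:E)%E.
Proof.
move=> mb cb mN cN c0_gt0 /andP[T_gt0 TT0] M_gt0 th_gt0 eqb N4 ball.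
set kappa := 2 + _.
have Q_ge0 : 0 <= c0 * (T0 + 2 * b0 ^+ 2 / c0 + M).
  rewrite mulr_ge0 ?(ltW c0_gt0)// !addr_ge0 ?(ltW M_gt0)//.
    by rewrite (le_trans _ TT0)// ltW.
  by rewrite divr_ge0 ?(ltW c0_gt0)// mulr_ge0 ?sqr_ge0.
have k_gt0 : 0 < kappa by rewrite ltr_wpDr.
pose r := 2 * (kappa * theta).
have r_gt0 : 0 < r by rewrite !mulr_gt0.
pose F1 (z : RT * Om) := N z.1 z.2 ^+ 4.
pose F2 (z : RT * Om) := \1_[set x : R | `|x| <= r] (b0 + N z.1 z.2) : R.
have mF1 : measurable_fun [set: RT * Om] F1.
  by apply: measurable_funX; exact: measurable_fun_continuous_section.
have mF2 : measurable_fun [set: RT * Om] F2.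
  apply: measurableT_comp.
    by apply: measurable_indic; exact: measurable_norm_le.
  by apply: measurable_funD => //; exact: measurable_fun_continuous_section.
have F1_ge0 z : 0 <= F1 z.
  by rewrite /F1 (_ : _ ^+ 4 = (N z.1 z.2 ^+ 2) ^+ 2) ?sqr_ge0// -exprM.
have F2_ge0 z : 0 <= F2 z by rewrite /F2 indicE.
have K_ge0 : 0 <= K.
  have := N4 0; rewrite lexx (ltW T_gt0) => /(_ isT) N40.
  rewrite -lee_fin (le_trans _ N40)//.
  by apply: integral_ge0 => w _; rewrite lee_fin (F1_ge0 (0, w)).
pose A1 := [set w | M%:E <= \int[mu]_(t in `[0%R, T]) (F1 (t, w))%:E]%E.
pose A2 := [set w | (T / 4)%:E <= \int[mu]_(t in `[(T / 2)%R, T]) (F2 (t, w))%:E]%E.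
have mA (D : set RT) (F : RT * Om -> R) (a : R) : measurable D ->
    measurable_fun [set: RT * Om] F ->
    measurable [set w | a%:E <= \int[mu]_(t in D) (F (t, w))%:E]%E.
  move=> mD mF; rewrite -[X in measurable X]setTI; apply: emeasurable_fun_c_infty.
    exact: measurableT.
  by apply: (measurable_integral_section (F := fun z => (F z)%:E)) => //; exact/measurable_EFinP.
have mA1 : measurable A1 by exact: mA.
have mA2 : measurable A2 by exact: mA.
have sub : [set w | Rintegral mu `[0, T] (fun s => b s w ^+ 2) <= theta ^+ 2 * T]
    `<=` A1 `|` A2.
  move=> w /= bw; have [|NM] := leP M%:E (\int[mu]_(t in `[0%R, T]) (F1 (t, w))%:E)%E.
    by left.
  right; rewrite /A2 /=.
  have N4w : Rintegral mu `[0, T] (fun s => N s w ^+ 4) <= M.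
    (* A real integral takes the value 0 when the extended one is infinite. This is harmless here,
       as [M > 0]; below, the bound [T / 4 > 0] is incompatible with that default. *)
    rewrite /Rintegral; move: NM; rewrite /F1/=.
    by case: (integral _ _ _) => //= [x|_]; [rewrite lte_fin => /ltW|exact: ltW].
  have TT : 0 < T <= T0 by rewrite T_gt0.
  have := Rintegral_noise_sqr_le c0_gt0 TT th_gt0 (cb w) (cN w) (eqb w) N4w bw.
  set D2 := 2 + 2 * _ => NK.
  (* With [Q = kappa - 2 >= 0], the left side is [2 + Q^2 / 2], which is below [(2 + Q)^2]. *)
  have D2k : D2 <= kappa ^+ 2.
    by rewrite /D2 /kappa; move: Q_ge0; set Q := c0 * _ => Q_ge0; have := sqr_ge0 Q; lra.
  have cg : continuous (fun t => b0 + N t w).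
    by move=> t; apply: cvgD; [exact: cvg_cst|exact: cN].
  have kt : 0 < kappa * theta by rewrite mulr_gt0.
  have := occupation_ge kt T_gt0 cg; rewrite -/r.
  have -> : Rintegral mu `[0, T] (fun s => (b0 + N s w) ^+ 2) <= (kappa * theta) ^+ 2 * T.
    by rewrite (le_trans NK)// exprMn ler_wpM2r ?(ltW T_gt0)// ler_wpM2r ?sqr_ge0.
  move=> /(_ isT); rewrite /Rintegral /F2/=.
  have T4 : 0 < T / 4 by rewrite divr_gt0.
  case: (integral _ _ _) => [x| |] //=; first by rewrite leey.
  by rewrite leNgt T4.
apply: (le_trans (le_measure P _ _ sub)); rewrite ?inE.
- exact: measurable_small_energy.
- exact: measurableU.
apply: (le_trans (measureU2 _ _ _)) => //.
have [p1 P1] : exists p, P A1 = p%:E by exists (fine (P A1)); rewrite fineK// fin_num_measure.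
have [p2 P2] : exists p, P A2 = p%:E by exists (fine (P A2)); rewrite fineK// fin_num_measure.
have := markov_integral_section (P := P) (K := K) (measurable_itv `[0, T]) mF1 F1_ge0 M_gt0.
rewrite -/A1 P1 /= lebesgue_measure_itv/= lte_fin T_gt0 oppr0 adde0 -!EFinM lee_fin.
have T4 : 0 < T / 4 by rewrite divr_gt0.
have : (forall t, `[T / 2, T]%classic t -> (\int[P]_w (F2 (t, w))%:E <= (r * S)%:E)%E) ->
    ((T / 4)%:E * P A2 <= (r * S)%:E * mu `[(T / 2)%R, T])%E.
  exact: (markov_integral_section (P := P) (measurable_itv `[T / 2, T]) mF2 F2_ge0 T4).
rewrite P2 /= lebesgue_measure_itv/= lte_fin.
have -> : T / 2 < T by lra.
rewrite -EFinB -!EFinM !lee_fin => H2 H1.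
have {}H1 : M * p1 <= K * T.
  by apply: H1 => t; rewrite in_itv/= => tT; exact: N4.
have {}H2 : T / 4 * p2 <= r * S * (T - T / 2).
  apply: H2 => t; rewrite in_itv/= => tT.
  rewrite (le_trans _ (ball t r tT (ltW r_gt0)))// /F2 /=.
  rewrite (eq_integral (fun w => (\1_[set w | `|b0 + N t w| <= r] w)%:E)); last first.
    by move=> w _; rewrite !indicE; congr (_%:R%:E); apply/idP/idP; rewrite !inE.
  rewrite integral_indic ?setIT//.
  rewrite [X in measurable X](_ : _ = (fun w => b0 + N t w) @^-1` [set x | `|x| <= r])//.
  rewrite -[X in measurable X]setTI; have := @measurable_norm_le R r.
  by apply: measurable_funD => //.
rewrite P1 -EFinD lee_fin lerD//.
  rewrite ler_pdivlMr// mulrC (le_trans H1)//.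
  by rewrite ler_wpM2l.
have -> : 4 * S * kappa * theta = r * S * 2 by rewrite /r; ring.
rewrite -(ler_pM2l T4) (le_trans H2)//.
suff -> : T / 4 * (r * S * 2) = r * S * (T - T / 2) by [].
by field.
Qed.

End small_energy.

(** * One-dimensional marginals of the rescaled noise *)

Section rescaled_marginals.
Context {d : measure_display} {Om : measurableType d} {R : realType}.
Variables (P : probability Om R) (H q g : R) (X : R -> {RV P >-> R}).
Hypotheses (H_gt0 : 0 < H) (g_gt0 : 0 < g).
Hypothesis fbm : fractional_brownian_motion H q X.

Lemma measurable_rescaled t : measurable_fun [set: Om] (rescaled H g X t).
Proof. by apply: measurable_funM. Qed.

Lemma gaussian_rescaled t : 0 <= t -> gaussian_rv P (rescaled H g X t).
Proof.
move=> t_ge0; have [gp _ _ _] := fbm.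
have := gp 1%N (fun=> t * g ^- 2) (fun=> g `^ (2 * H)).
under eq_fun do rewrite big_ord1.
by apply=> _; rewrite mulr_ge0// invr_ge0 sqr_ge0.
Qed.

Let integral_sqr u : 0 <= u ->
  (\int[P]_w (X u w ^+ 2)%:E = (q * u `^ (2 * H))%:E)%E.
Proof.
move=> u_ge0; have [_ EX CX _] := fbm.
(* On the diagonal the increment term is 0 to the power [2 H], which vanishes because [H > 0]. *)
have := CX _ _ u_ge0 u_ge0; rewrite subrr normr0 powR0 ?mulf_neq0 ?gt_eqF// subr0.
rewrite unlock EX//= unlock => E.
have -> : q * u `^ (2 * H) = q / 2 * (u `^ (2 * H) + u `^ (2 * H)) by field.
rewrite -E; apply: eq_integral => w _ /=.
by rewrite -[RHS]/(((X u w - 0) * (X u w - 0))%:E) subr0 expr2.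
Qed.

Lemma integral_rescaled t : 0 <= t -> (\int[P]_w (rescaled H g X t w)%:E = 0)%E.
Proof.
move=> t_ge0; have [_ EX _ _] := fbm.
have u_ge0 : 0 <= t * g ^- 2 by rewrite mulr_ge0// invr_ge0 sqr_ge0.
rewrite /rescaled; under eq_integral do rewrite EFinM.
rewrite integralZl//; first by have := EX _ u_ge0; rewrite unlock => ->; rewrite mule0.
by apply: integrable_of_sqr (integral_sqr u_ge0).
Qed.

(** Self-similarity: the square of the factor [g^(2 H)] cancels the [(g^-2)^(2 H)] produced by the
    time change. Since [g] disappears, every later bound is uniform in epsilon. *)
Lemma integral_rescaled_sqr t : 0 <= t ->
  (\int[P]_w (rescaled H g X t w ^+ 2)%:E = (q * t `^ (2 * H))%:E)%E.
Proof.
move=> t_ge0.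
have u_ge0 : 0 <= t * g ^- 2 by rewrite mulr_ge0// invr_ge0 sqr_ge0.
rewrite /rescaled; under eq_integral do rewrite exprMn EFinM.
rewrite ge0_integralZl//; last 3 first.
- by apply/measurable_EFinP; exact: measurable_funX.
- by move=> w _; rewrite lee_fin sqr_ge0.
- by rewrite lee_fin sqr_ge0.
rewrite integral_sqr// -EFinM; congr EFin.
rewrite powRM// ?invr_ge0 ?sqr_ge0//.
have -> : (g ^- 2) `^ (2 * H) = (g `^ (2 * H)) ^- 2.
  rewrite -(powR_invn 2 (ltW g_gt0)) -powRrM [- 2%:R * _]mulrC [LHS]powRrM.
  by apply: powR_invn; exact: powR_ge0.
by field; rewrite gt_eqF// powR_gt0.
Qed.

Lemma rescaled0 : {ae P, forall w, rescaled H g X 0 w = 0}.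
Proof.
have [_ _ _ X0] := fbm; apply: filterS X0 => w [X0 _].
by rewrite /rescaled mul0r X0 mulr0.
Qed.

End rescaled_marginals.

(** * Small energy for solutions of the stochastic equation *)

Section small_energy_sde.
Context {d : measure_display} {Om : measurableType d} {R : realType}.
Variable P : probability Om R.
Local Notation mu := (@lebesgue_measure R).
Local Notation RT := (measurableTypeR R).

Lemma derive1_Fc (c0 x : R) : (Fc c0)^`()%classic x = - (3 * c0) * x ^+ 2.
Proof.
have -> : Fc c0 = - c0 *: (id ^+ 3 : R -> R) by [].
rewrite derive1E deriveZ ?deriveX//= derive_id.
by rewrite /GRing.scale/= mulr1; ring.
Qed.

(** The complement of [A] is exactly the small-energy event, because the derivative of [Fc c0] is
    [- 3 c0 x^2]. The remaining work is to replace the almost sure equation by one that holds on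
    every path. *)
Lemma sde_small_energy_prob_le (H q c0 T0 T b0 g M theta : R)
    (X b : R -> {RV P >-> R}) :
  0 < H -> 0 < q -> 0 < c0 -> 0 < g -> 0 < T <= T0 -> 0 < M -> 0 < theta ->
  fractional_brownian_motion H q X ->
  sde_solution (Fc c0) (rescaled H g X) b0 T0 b ->
  let A := [set w | lyapunov_exponent (Fc c0) T (fun s => b s w) < - (3 * c0) * theta ^+ 2] in
  measurable A /\
  (P (~` A) <= (600 * 600 * (q * T0 `^ (2 * H)) ^+ 2 * T0 / M +
    4 * (5 / Num.sqrt (q * (T / 2) `^ (2 * H))) *
      (2 + c0 * (T0 + 2 * b0 ^+ 2 / c0 + M)) * theta)%:E)%E.
Proof.
move=> H_gt0 q_gt0 c0_gt0 g_gt0 /andP[T_gt0 TT0] M_gt0 th_gt0 fbm [cb eqb].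
have T0_gt0 : 0 < T0 by exact: lt_le_trans TT0.
pose clip (t : R) := Num.max 0 (Num.min t T0).
have clipE t : 0 <= t <= T0 -> clip t = t.
  by move=> /andP[t0 tT]; rewrite /clip (min_idPl tT) (max_idPr t0).
have clip_in t : 0 <= clip t <= T0.
  by rewrite /clip le_max lexx/= ge_max (ltW T0_gt0) ge_min lexx orbT.
pose b' t w := b (clip t) w.
have mb' t : measurable_fun [set: Om] (b' t) by [].
have cb' w : continuous (b' ^~ w).
  by apply: (@continuous_clip R (fun t => b t w)) => //; exact: ltW.
have b'E t w : 0 <= t <= T0 -> b' t w = b t w by move=> tT; rewrite /b' clipE.
(* The noise is read off from the solution, so that the equation holds for every [w] and the paths
   of [N] inherit continuity from [b']. *)
pose N t w := b' t w - b0 + c0 * Rintegral mu `[0, t] (fun s => b' s w ^+ 3).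
pose N' t w := N (clip t) w.
have mN' t : measurable_fun [set: Om] (N' t).
  apply: measurable_funD; first exact: measurable_funB.
  apply: measurable_funM => //.
  apply: (measurable_Rintegral_section (F := fun z : RT * Om => b' z.1 z.2 ^+ 3)) => //.
  by apply: measurable_funX; exact: measurable_fun_continuous_section.
have b'i n w x y : mu.-integrable `[x, y] (EFin \o (fun t => b' t w ^+ n)).
  exact/continuous_itv_integrable/continuousX_fun.
have cN' w : continuous (N' ^~ w).
  apply: (@continuous_clip R (fun t => N t w)); first exact: ltW.
  move=> t; apply: cvgD.
    apply: cvgB; last exact: cvg_cst.
    exact: (@continuous_subspaceT _ _ `[0, T0]%classic (b' ^~ w) (cb' w) t).
  apply: cvgM; first exact: cvg_cst.
  exact: (parameterized_integral_continuous (ltW T0_gt0) (b'i 3 w 0 T0)).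
have subT t : 0 <= t <= T -> 0 <= t <= T0.
  by move=> /andP[-> /=] /le_trans; exact.
have eqb' w t : 0 <= t <= T ->
    b' t w = b0 - c0 * Rintegral mu `[0, t] (fun s => b' s w ^+ 3) + N' t w.
  by move=> /subT tT; rewrite /N' clipE// /N; ring.
(* Almost sure equality at each fixed time suffices to transfer the moment and small-ball bounds,
   which involve only the marginals. *)
have aeN t : 0 <= t <= T0 -> {ae P, forall w, N' t w = rescaled H g X t w}.
  move=> tT; apply: filterS2 eqb (rescaled0 g fbm) => w [_ /(_ t tT) bt] X0.
  rewrite /N' clipE// /N b'E// bt X0 subr0.
  have -> : Rintegral mu `[0, t] (fun s => Fc c0 (b s w)) =
      - c0 * Rintegral mu `[0, t] (fun s => b' s w ^+ 3).
    rewrite -RintegralZl; [|by []|exact: b'i].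
    apply: eq_Rintegral => s; rewrite inE/= in_itv/= => /andP[s0 st].
    by rewrite /Fc b'E// s0/= (le_trans st)//; case/andP: tT.
  by ring.
have N4 t : 0 <= t <= T ->
    (\int[P]_w (N' t w ^+ 4)%:E <= (600 * 600 * (q * T0 `^ (2 * H)) ^+ 2)%:E)%E.
  move=> /subT tT; have /andP[t0 tT0] := tT.
  rewrite (ae_eq_integral (fun w => (rescaled H g X t w ^+ 4)%:E))//; last 3 first.
  - by apply/measurable_EFinP; exact: measurable_funX.
  - by apply/measurable_EFinP; apply: measurable_funX; exact: measurable_rescaled.
  - by apply: filterS (aeN t tT) => w ->.
  have := gaussian_fourth_moment_le (measurable_rescaled H g X t)
    (gaussian_rescaled g fbm t0) (integral_rescaled g H_gt0 fbm t0)
    (integral_rescaled_sqr H_gt0 g_gt0 fbm t0).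
  move=> /le_trans; apply; rewrite lee_fin.
  apply: ler_wpM2l; first by rewrite mulr_ge0 ?ler0n.
  rewrite lerXn2r ?nnegrE ?mulr_ge0 ?powR_ge0 ?(ltW q_gt0)//.
  rewrite ler_wpM2l ?(ltW q_gt0)// ge0_ler_powR ?nnegrE ?mulr_ge0 ?(ltW H_gt0)//.
  exact: ltW.
have ball t r : T / 2 <= t <= T -> 0 <= r ->
    (P [set w | `|b0 + N' t w| <= r]%R <=
      (r * (5 / Num.sqrt (q * (T / 2) `^ (2 * H))))%:E)%E.
  move=> /andP[Tt tT] r_ge0.
  have t_gt0 : 0 < t by rewrite (lt_le_trans _ Tt)// divr_gt0.
  have t_ge0 := ltW t_gt0.
  have tT0 : 0 <= t <= T0 by rewrite t_ge0 (le_trans tT).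
  have mball Z : measurable_fun [set: Om] Z ->
      measurable [set w | `|b0 + Z w| <= r].
    move=> mZ; rewrite [X in measurable X](_ : _ =
      (fun w => b0 + Z w) @^-1` [set x | `|x| <= r])//.
    rewrite -[X in measurable X]setTI; have := @measurable_norm_le R r.
    by apply: measurable_funD.
  have v_gt0 s : 0 < s -> 0 < q * s `^ (2 * H) by move=> s0; rewrite mulr_gt0// powR_gt0.
  have := gaussian_ball_le (measurable_rescaled H g X t)
    (gaussian_rescaled g fbm t_ge0) (integral_rescaled g H_gt0 fbm t_ge0)
    (integral_rescaled_sqr H_gt0 g_gt0 fbm t_ge0) b0 (v_gt0 t t_gt0) r_ge0.
  have -> : P [set w | `|b0 + rescaled H g X t w| <= r] = P [set w | `|b0 + N' t w| <= r].
    rewrite -[X in P X = _]setIT -[X in _ = P X]setIT.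
    have mr := mball _ (measurable_rescaled H g X t).
    have mn := mball _ (mN' t).
    rewrite -!integral_indic//; apply: ae_eq_integral => //.
    - by apply/measurable_EFinP; exact: measurable_indic.
    - by apply/measurable_EFinP; exact: measurable_indic.
    - apply: filterS (aeN t tT0) => w Nw _; rewrite !indicE; congr ((nat_of_bool _)%:R%:E).
      by apply/idP/idP; rewrite !inE/= Nw.
  (* The variance increases with time, so its value at [T / 2] is a lower bound throughout
     [[T / 2, T]]. *)
  move=> /le_trans; apply; rewrite lee_fin [leRHS]mulrCA mulrA.
  rewrite ler_wpM2l ?mulr_ge0// lef_pV2 ?posrE ?sqrtr_gt0 ?v_gt0 ?divr_gt0//.
  rewrite ler_wsqrtr// ler_wpM2l ?(ltW q_gt0)// ge0_ler_powR//.
  - by rewrite mulr_ge0 ?(ltW H_gt0).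
  - by rewrite nnegrE divr_ge0// ltW.
have TT : 0 < T <= T0 by rewrite T_gt0.
have := small_energy_prob_le mb' cb' mN' cN' c0_gt0 TT M_gt0 th_gt0 eqb' N4 ball.
have := measurable_small_energy T (theta ^+ 2 * T) mb' cb'.
set B := [set w | _] => mB PB A.
have AE : A = ~` B.
  (* The exponent is [- 3 c0 / T] times the energy; dividing by the negative factor reverses the
     inequality. *)
  have lyapE w : (lyapunov_exponent (Fc c0) T (fun s => b s w) < - (3 * c0) * theta ^+ 2) =
      ~~ (Rintegral mu `[0, T] (fun s => b' s w ^+ 2) <= theta ^+ 2 * T).
    rewrite /lyapunov_exponent expRK -ltNge.
    have -> : Rintegral mu `[0, T] (fun s => (Fc c0)^`()%classic (b s w)) =
        - (3 * c0) * Rintegral mu `[0, T] (fun s => b' s w ^+ 2).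
      rewrite -RintegralZl; [|by []|exact: b'i].
      apply: eq_Rintegral => s; rewrite inE/= in_itv/= => /subT sT.
      by rewrite derive1_Fc b'E.
    by rewrite mulrCA ltr_nM2l ?oppr_lt0 ?mulr_gt0// ltr_pdivlMl// mulrC.
  by apply/seteqP; split => w; rewrite /A /B /= lyapE => /negP.
by rewrite AE setCK; split => //; exact: measurableC.
Qed.

End small_energy_sde.

(** * Choice of the time scale and conclusion *)

Lemma powR_half_ge (R : realType) (H T theta : R) :
  0 < H < 1 -> 0 < theta -> theta `^ (1 / (2 * H)) <= T ->
  theta / 4 <= (T / 2) `^ (2 * H).
Proof.
move=> /andP[H_gt0 H_lt1] th_gt0 thT.
have H2_ge0 : 0 <= 2 * H by rewrite mulr_ge0// ltW.
have T_ge0 : 0 <= T by rewrite (le_trans _ thT)// powR_ge0.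
(* The threshold on [T] gives [T^(2 H) >= theta], and [(1 / 2)^(2 H) >= 1 / 4] because [H < 1]. *)
rewrite powRM ?invr_ge0//; apply: ler_pM => //; first exact: ltW.
  rewrite [leLHS](_ : theta = (theta `^ (1 / (2 * H))) `^ (2 * H)).
    by apply: ge0_ler_powR => //; rewrite nnegrE// powR_ge0.
  rewrite -powRrM mul1r mulVf ?powRr1 ?(ltW th_gt0)// mulf_neq0// gt_eqF//.
rewrite -(powR_inv1 (ler0n _ 2)) -powRrM mulN1r powRN.
have -> : 4 = (2 : R) `^ 2 by rewrite powR_mulrn//; ring.
by rewrite lef_pV2 ?posrE ?powR_gt0// ler_powR ?ler1n//; lra.
Qed.

Theorem lemma4p2 (d : measure_display) (Om : measurableType d) (R : realType)
    (P : probability Om R) (H q c0 T0 b0 : R) (nu sigma : R -> R)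
    (beta : R -> {RV P >-> R}) (b : R -> R -> {RV P >-> R})
    (hH : 0 < H < 1) (hq : 0 < q) (hc0 : 0 < c0) (hT0 : 0 < T0)
    (hnu : forall eps, 0 < eps -> 0 <= nu eps)
    (hsigma : forall eps, 0 < eps -> 0 < sigma eps)
    (hnuO : bigO_eps nu (fun eps => eps ^+ 2))
    (hsigmaO : bigO_eps sigma (fun eps => eps `^ (2 * H + 1)))
    (hnusigma : much_smaller (fun eps => nu eps `^ (H + 1 / 2)) sigma)
    (hbeta : fractional_brownian_motion H q beta)
    (hb : forall eps, 0 < eps ->
       sde_solution (Fc c0) (rescaled H (sigma eps `^ H) beta) b0 T0 (b eps)) :
  exists (c : R) (Tm : R -> R),
    [/\ 0 < c,
        forall theta, 0 < theta -> 0 < Tm theta,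
        Tm theta @[theta --> 0^'+] --> (0 : R) &
        forall eta : R, 0 < eta ->
          \forall theta \near 0^'+,
            forall eps T, 0 < eps -> Tm theta <= T <= T0 ->
              ((1 - eta)%:E <=
               P [set w | lyapunov_exponent (Fc c0) T (fun s => b eps s w)
                            < - c * theta ^+ 2]%R)%E].
Proof.
have [H_gt0 H_lt1] := andP hH.
(* With this time scale the standard deviation of the noise on [[T / 2, T]] is at least
   [sqrt(q theta) / 2], so a ball of radius of order [theta] has probability of order
   [sqrt theta]. *)
exists (3 * c0), (fun theta => theta `^ (1 / (2 * H))); split.
- by rewrite mulr_gt0.
- by move=> theta th_gt0; exact: powR_gt0.
- by apply: powR_cvg0; rewrite divr_gt0// mulr_gt0.
move=> eta eta_gt0.
pose K := 600 * 600 * (q * T0 `^ (2 * H)) ^+ 2.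
have K_gt0 : 0 < K.
  apply: mulr_gt0; first by rewrite mulr_gt0 ?ltr0n.
  by rewrite exprn_gt0// mulr_gt0// powR_gt0.
(* [M] makes the fourth-moment contribution [K T0 / M] equal to [eta / 2]. *)
pose M := 2 * K * T0 / eta.
have M_gt0 : 0 < M by rewrite divr_gt0// mulr_gt0// mulr_gt0.
pose kappa := 2 + c0 * (T0 + 2 * b0 ^+ 2 / c0 + M).
have kappa_gt0 : 0 < kappa.
  rewrite ltr_wpDr// mulr_ge0 ?(ltW hc0)// !addr_ge0 ?(ltW hT0) ?(ltW M_gt0)//.
  by rewrite divr_ge0 ?(ltW hc0)// mulr_ge0 ?sqr_ge0.
(* [delta] solves [40 kappa delta / sqrt q = eta / 2], so the small-ball contribution is at most
   [eta / 2] once [sqrt theta <= delta]. This threshold depends on neither epsilon nor [T]. *)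
pose delta := eta * Num.sqrt q / (80 * kappa).
have sq_gt0 : 0 < Num.sqrt q by rewrite sqrtr_gt0.
have delta_gt0 : 0 < delta by rewrite divr_gt0 ?mulr_gt0.
near=> theta => eps T eps_gt0 /andP[thT TT0].
have th_gt0 : 0 < theta by near: theta; exact: nbhs_right_gt.
have th_le : theta <= delta ^+ 2.
  by near: theta; apply: nbhs_right_le; rewrite exprn_gt0.
have T_gt0 : 0 < T by rewrite (lt_le_trans _ thT)// powR_gt0.
have TT : 0 < T <= T0 by rewrite T_gt0.
have [mA PA] := sde_small_energy_prob_le H_gt0 hq hc0
  (powR_gt0 H (hsigma eps eps_gt0)) TT M_gt0 th_gt0 hbeta (hb eps eps_gt0).
rewrite -[X in P X]setCK probability_setC; last exact: measurableC.
rewrite EFinB; apply: leeB => //; apply: (le_trans PA); rewrite lee_fin -/K -/kappa.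
have -> : K * T0 / M = eta / 2 by rewrite /M; field; rewrite !gt_eqF.
suff : 4 * (5 / Num.sqrt (q * (T / 2) `^ (2 * H))) * kappa * theta <= eta / 2 by lra.
pose s := Num.sqrt theta.
have s_gt0 : 0 < s by rewrite sqrtr_gt0.
have thE : theta = s ^+ 2 by rewrite sqr_sqrtr// ltW.
have s_le : s <= delta.
  by rewrite -[leRHS]gtr0_norm// -sqrtr_sqr ler_wsqrtr.
have as_gt0 : 0 < Num.sqrt q * s / 2 by rewrite !mulr_gt0.
have as_le : Num.sqrt q * s / 2 <= Num.sqrt (q * (T / 2) `^ (2 * H)).
  have -> : Num.sqrt q * s / 2 = Num.sqrt (q * (theta / 4)).
    rewrite -[LHS]gtr0_norm// -sqrtr_sqr; congr Num.sqrt.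
    by rewrite thE !exprMn sqr_sqrtr ?(ltW hq)// exprVn; field.
  by rewrite ler_wsqrtr// ler_wpM2l ?(ltW hq)// powR_half_ge.
apply: (@le_trans _ _ (4 * (5 / (Num.sqrt q * s / 2)) * kappa * theta)).
  rewrite ler_wpM2r ?(ltW th_gt0)// ler_wpM2r ?(ltW kappa_gt0)//.
  rewrite ler_wpM2l// ler_wpM2l// lef_pV2 ?posrE//.
  exact: lt_le_trans as_le.
have -> : 4 * (5 / (Num.sqrt q * s / 2)) * kappa * theta = 40 * kappa / Num.sqrt q * s.
  by rewrite thE; field; rewrite !gt_eqF.
apply: (@le_trans _ _ (40 * kappa / Num.sqrt q * delta)).
  by rewrite ler_wpM2l// divr_ge0 ?(ltW sq_gt0)// mulr_ge0// ltW.
suff -> : 40 * kappa / Num.sqrt q * delta = eta / 2 by [].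
by rewrite /delta; field; rewrite !gt_eqF.
Unshelve. all: by end_near. Qed.
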